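(* Let $\mathfrak{g}$ be a real semisimple Lie algebra. A quaternionic (resp. real) $\mathbb{C}$-representation $\rho$ of $\mathfrak{g}$ admits a unique antiinvolution of the second (resp. first) kind up to equivalence.
   Context: All representations are finite dimensional. A $\mathbb{C}$-representation is an $\mathbb{R}$-linear Lie algebra homomorphism $\rho:\mathfrak{g}\to\mathrm{End}_{\mathbb{C}}(V)$, not necessarily irreducible. An antiinvolution of the first (resp. second) kind on $\rho$ is a $\rho$-equivariant antilinear map $J:V\to V$ with $J^2=1$ (resp. $J^2=-1$). $\rho$ is real (resp. quaternionic) if it admits an antiinvolution of the first (resp. second) kind. Two antiinvolutions $J_1,J_2$ of the same kind on $\rho$ are equivalent if there is a $\rho$-equivariant $\mathbb{C}$-linear automorphism $f$ of $V$ with $f\circ J_1=J_2\circ f$. *)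

(* Defs.v *)
From HB Require Import structures.
From mathcomp Require Import all_boot all_order all_algebra.
From mathcomp Require Import complex reals.

Set Implicit Arguments.
Unset Strict Implicit.
Unset Printing Implicit Defensive.

Import Order.TTheory GRing.Theory Num.Theory.
Local Open Scope ring_scope.
Local Open Scope complex_scope.

HB.mixin Record Vector_isLieAlgebra (K : fieldType) g of Vector K g := {
  lie_bracket : g -> g -> g;
  lie_linearl : forall y, linear (lie_bracket^~ y);
  lie_linearr : forall x, linear (lie_bracket x);
  lie_alternating : forall x, lie_bracket x x = 0;
  lie_jacobi : forall x y z,
    lie_bracket x (lie_bracket y z) + lie_bracket y (lie_bracket z x)
      + lie_bracket z (lie_bracket x y) = 0
}.

(* finite-dimensional Lie algebras over K *)
#[short(type="lieAlgType")]
HB.structure Definition LieAlgebra (K : fieldType) :=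
  { g of Vector_isLieAlgebra K g & Vector K g }.

Notation "[ 'lie' x , y ]" := (lie_bracket x y)
  (at level 0, format "[ 'lie'  x ,  y ]") : ring_scope.

Section Semisimple.
Variables (K : fieldType) (g : lieAlgType K).

Definition lie_ideal (I : {vspace g}) : Prop :=
  forall x y : g, y \in I -> [lie x, y] \in I.

(* The span of all brackets [u, v], u in U, v in V: by bilinearity it is spanned
   by the brackets of basis vectors. *)
Definition lie_prod (U V : {vspace g}) : {vspace g} :=
  <<[seq [lie u, v] | u <- vbasis U, v <- vbasis V]>>%VS.

Definition derived_series (U : {vspace g}) (n : nat) : {vspace g} :=
  iter n (fun W => lie_prod W W) U.

Definition lie_solvable (U : {vspace g}) : Prop :=
  exists n : nat, derived_series U n = 0%VS.

(* Semisimple means zero radical; in particular the zero algebra counts as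
   semisimple. *)
Definition lie_semisimple : Prop :=
  forall I : {vspace g}, lie_ideal I -> lie_solvable I -> I = 0%VS.

End Semisimple.

(* R-linear Lie algebra homomorphisms from g to End_C(V); the R-module structure
   on End_C(V) is the restriction of scalars along R -> R[i]. *)
Record crepr (R : realType) (g : lieAlgType R) (V : vectType R[i]) := CRepr {
  crepr_fun :> {linear g -> 'End(V) | real_complex R \; *:%R};
  crepr_lie : forall x y : g,
    crepr_fun [lie x, y] = (crepr_fun x \o crepr_fun y)%VF
                             - (crepr_fun y \o crepr_fun x)%VF
}.

Section Antiinvolutions.
Variables (R : realType) (g : lieAlgType R) (V : vectType R[i]).
Variable rho : crepr g V.

Definition antilinear (J : V -> V) : Prop :=
  forall (a : R[i]) (u v : V), J (a *: u + v) = a^* *: J u + J v.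

Definition equivariant (J : V -> V) : Prop :=
  forall (x : g) (v : V), J (rho x v) = rho x (J v).

Definition antiinvolution1 (J : V -> V) : Prop :=
  [/\ antilinear J, equivariant J & forall v, J (J v) = v].

Definition antiinvolution2 (J : V -> V) : Prop :=
  [/\ antilinear J, equivariant J & forall v, J (J v) = - v].

Definition real_crepr : Prop := exists J, antiinvolution1 J.
Definition quaternionic_crepr : Prop := exists J, antiinvolution2 J.

Definition antiinvolution_equiv (J1 J2 : V -> V) : Prop :=
  exists f : 'End(V),
    [/\ bijective f, equivariant f & forall v, f (J1 v) = J2 (f v)].

End Antiinvolutions.

Definition unique_up_to (T : Type) (P : T -> Prop) (E : T -> T -> Prop) : Prop :=
  (exists x, P x) /\ (forall x y, P x -> P y -> E x y).

(* Main.v *)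
Require Import Defs.
From HB Require Import structures.
From mathcomp Require Import all_boot all_order all_algebra.
From mathcomp Require Import complex reals.
From mathcomp Require Import ring.

(** Uniqueness is Hilbert's Theorem 90 for the unit group of the commutant of
    [rho], with complex conjugation acting by conjugation by [J1].  Let [J1] and
    [J2] be equivariant antilinear maps with the same square [e = 1] or
    [e = -1].  Then [J2 = a \o J1] with [a = e^-1 J2 J1], a complex-linear
    equivariant map, and equality of the squares says that [a] is a cocycle.
    For every scalar [l] the averaged map [f = l + conj(l) a] is equivariant and
    satisfies

      [f J1 = l J1 + conj(l) J2 = J2 f],

    so [f] is the required equivalence as soon as it is bijective, that is, as
    soon as [- l / conj(l)] is not an eigenvalue of [a]
    ([intertwiner_of_same_square]).  The numbers [- l / conj(l)] for
    [l = n + 'i], [n] a natural number, are pairwise distinct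
    ([phase_inj]), whereas [a] has finitely many eigenvalues, so some [n] works
    ([exists_not_eigenvalue]). *)

Set Implicit Arguments.
Unset Strict Implicit.
Unset Printing Implicit Defensive.

Import Order.TTheory GRing.Theory Num.Theory VectorInternalTheory.
Local Open Scope ring_scope.
Local Open Scope complex_scope.

Lemma exists_not_root (K : fieldType) (p : {poly K}) (s : nat -> K) :
  p != 0 -> injective s -> exists n, ~~ root p (s n).
Proof.
move=> p_neq0 s_inj; pose rs := [seq s n | n <- iota 0 (size p)].
case: (boolP (all (root p) rs)) => [rs_roots | /allPn[_ /mapP[n _ ->]]].
  have rs_uniq : uniq rs by rewrite map_inj_uniq ?iota_uniq.
  have := max_poly_roots p_neq0 rs_roots rs_uniq.
  by rewrite size_map size_iota ltnn.
by exists n.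
Qed.

Lemma exists_not_eigenvalue (K : fieldType) (V : vectType K) (a : 'End(V))
    (s : nat -> K) :
  injective s -> exists n, forall v, a v = s n *: v -> v = 0.
Proof.
move=> s_inj.
have [n] := exists_not_root (monic_neq0 (char_poly_monic (f2mx a))) s_inj.
rewrite -eigenvalue_root_char => /eigenvalueP no_eig.
exists n => v av; apply/eqP/negPn/negP => v_neq0; apply: no_eig.
exists (v2r v); first by rewrite -linearZ -av unlock /= r2vK.
by apply: contra v_neq0 => /eqP v0; rewrite -(v2rK v) v0 linear0.
Qed.

Lemma lfun_of_linear (K : fieldType) (V : vectType K) (h : V -> V) :
  linear h -> exists f : 'End(V), f =1 h.
Proof.
move=> h_lin.
pose hL : {linear V -> V} := HB.pack h (GRing.isLinear.Build _ _ _ _ h h_lin).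
by exists (linfun hL) => v; rewrite lfunE.
Qed.

Lemma bijective_of_lker0 (K : fieldType) (V : vectType K) (f : 'End(V)) :
  (forall v, f v = 0 -> v = 0) -> bijective f.
Proof.
move=> f_inj; have kerf : lker f == 0%VS.
  by apply/lker0P/raddf_inj.
by exists (f^-1)%VF; [exact: lker0_lfunK | exact: lker0_lfunVK].
Qed.

Section Phase.
Variable C : numClosedFieldType.

Lemma natDi_neq0 (n : nat) : n%:R + 'i != 0 :> C.
Proof.
have norm_n : (n%:R + 'i) * (n%:R - 'i) = n%:R ^+ 2 + 1 :> C.
  by have := sqrCi C => i2; ring: i2.
have : n%:R ^+ 2 + 1 != 0 :> C by rewrite -natrX natr1 pnatr_eq0.
by rewrite -norm_n mulf_eq0 negb_or => /andP[].
Qed.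

(** [n + 'i] determines [n] even up to a positive real factor, that is, through
    its argument, and [l / l^*] is the square of the phase of [l]; these
    arguments lie in an open half-turn, where squaring phases is injective. *)
Lemma phase_inj :
  injective (fun n : nat => - ((n%:R + 'i) / (n%:R + 'i)^*) : C).
Proof.
move=> m n /oppr_inj /eqP; rewrite eqr_div ?conjC_eq0 ?natDi_neq0 //.
rewrite !rmorphD /= !conjC_nat conjCi -subr_eq0.
have -> : (m%:R + 'i) * (n%:R - 'i) - (n%:R + 'i) * (m%:R - 'i) =
    2%:R * 'i * (n%:R - m%:R) :> C by ring.
by rewrite !mulf_eq0 pnatr_eq0 (negPf (neq0Ci C)) /= subr_eq0 eqr_nat eq_sym
  => /eqP.
Qed.

End Phase.

Section Antilinear.
Variables (R : realType) (V : vectType R[i]) (J : V -> V).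
Hypothesis J_anti : antilinear J.

Lemma antilinearD u v : J (u + v) = J u + J v.
Proof. by have := J_anti 1 u v; rewrite conjC1 !scale1r. Qed.

Lemma antilinear0 : J 0 = 0.
Proof. by apply: (addrI (J 0)); rewrite -antilinearD !addr0. Qed.

Lemma antilinearZ c v : J (c *: v) = c^* *: J v.
Proof. by have := J_anti c v 0; rewrite antilinear0 !addr0. Qed.

End Antilinear.

(** Both kinds of antiinvolution are covered by letting the common square be a
    nonzero real scalar [e]; its reality is what makes [J2] commute with the
    factor [e^-1] in [a]. *)
Lemma intertwiner_of_same_square (R : realType) (g : lieAlgType R)
    (V : vectType R[i]) (rho : crepr g V) (e : R[i]) (J1 J2 : V -> V) :
    (e^*)%R = e -> e != 0 ->
    antilinear J1 -> equivariant rho J1 -> (forall v, J1 (J1 v) = e *: v) ->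
    antilinear J2 -> equivariant rho J2 -> (forall v, J2 (J2 v) = e *: v) ->
  antiinvolution_equiv rho J1 J2.
Proof.
move=> e_real e_neq0 J1_anti J1_rho J1_sq J2_anti J2_rho J2_sq.
have [a aE] : exists a : 'End(V), a =1 fun v => e^-1 *: J2 (J1 v).
  apply: lfun_of_linear => c u v.
  by rewrite J1_anti J2_anti conjCK scalerDr !scalerA mulrC.
(* A kernel vector of [l + conj(l) a] is an eigenvector of [a] for
   [- l / conj(l)], the value that [n] is chosen to avoid. *)
have [n n_ok] := exists_not_eigenvalue a (@phase_inj R[i]).
have := natDi_neq0 R[i] n; move: n_ok.
set l : R[i] := n%:R + 'i => n_ok l_neq0.
pose f : 'End(V) := l *: \1%VF + l^*%R *: a.
have fE v : f v = l *: v + l^*%R *: a v.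
  by rewrite add_lfunE !scale_lfunE id_lfunE.
exists f; split.
- apply: bijective_of_lker0 => v; rewrite fE => /eqP.
  rewrite addrC addr_eq0 => /eqP av; apply: n_ok.
  have lc_neq0 : l^*%R != 0 by rewrite conjC_eq0.
  by apply: (scalerI lc_neq0);
     rewrite av scalerA mulrN mulrCA divff ?mulr1 ?scaleNr.
- move=> x v; rewrite !fE !aE J1_rho J2_rho.
  by rewrite [RHS]linearD !(linearZZ (rho x)).
- move=> v; rewrite !fE !aE J1_sq.
  rewrite (antilinearZ J2_anti) e_real.
  rewrite antilinearD // !(antilinearZ J2_anti) J2_sq conjCK.
  by rewrite fmorphV /= e_real !scalerA !divfK // addrC.
Qed.

Theorem theorem4p17 (R : realType) (g : lieAlgType R) (hg : lie_semisimple g)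
    (V : vectType R[i]) (rho : crepr g V) :
  (quaternionic_crepr rho ->
     unique_up_to (antiinvolution2 rho) (antiinvolution_equiv rho)) /\
  (real_crepr rho ->
     unique_up_to (antiinvolution1 rho) (antiinvolution_equiv rho)).
Proof.
split=> [[J0 J0_inv] | [J0 J0_inv]]; split; try by exists J0.
- move=> J1 J2 [J1_anti J1_rho J1_sq] [J2_anti J2_rho J2_sq].
  apply: (@intertwiner_of_same_square _ _ _ _ (-1)) => //.
  + exact: rmorphN1.
  + by rewrite oppr_eq0 oner_eq0.
  + by move=> v; rewrite scaleN1r.
  + by move=> v; rewrite scaleN1r.
- move=> J1 J2 [J1_anti J1_rho J1_sq] [J2_anti J2_rho J2_sq].
  apply: (@intertwiner_of_same_square _ _ _ _ 1) => //.
  + exact: conjC1.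
  + exact: oner_neq0.
  + by move=> v; rewrite scale1r.
  + by move=> v; rewrite scale1r.
Qed.
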